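(* Let $E\subset\mathbb{C}^N$ be compact and let $\mu$ be a finite positive Borel measure on $E$ such that $(E,\mu)$ satisfies a Bernstein–Markov inequality. For $d=1,2,\dots$ let $$Z_d=Z_d(E,\mu):=\int_{E^{m_d}}|VDM(\lambda^{(1)},\dots,\lambda^{(m_d)})|^2\,d\mu(\lambda^{(1)})\cdots d\mu(\lambda^{(m_d)}).$$ Then $$\lim_{d\to\infty}Z_d^{1/(2l_d)}=d(E),$$ where $d(E)$ is the transfinite diameter of $E$.
   Context: Let $e_1(z),e_2(z),\dots$ be a listing of the monomials $e_i(z)=z^{\alpha(i)}$ in $\mathbb{C}^N$, using a lexicographic ordering on the multiindices $\alpha(i)\in\{0,1,2,\dots\}^N$ but with $\deg e_i=|\alpha(i)|$ nondecreasing. $m_d=\binom{N+d}{d}$ is the number of monomials of degree at most $d$ in $N$ variables and $l_d=N\binom{N+d}{N+1}$ is the sum of their degrees. $VDM(\zeta_1,\dots,\zeta_n)=\det[e_i(\zeta_j)]_{i,j=1,\dots,n}$. The transfinite diameter of a compact set $E\subset\mathbb{C}^N$ is $d(E)=\lim_{d\to\infty}\bigl[\max_{\zeta_1,\dots,\zeta_{m_d}\in E}|VDM(\zeta_1,\dots,\zeta_{m_d})|\bigr]^{1/l_d}$ (the limit exists by a theorem of Zaharjuta). $(E,\mu)$ satisfies the Bernstein–Markov inequality (for holomorphic polynomials in $\mathbb{C}^N$) if for every $\epsilon>0$ there is a constant $M=M(\epsilon)$ such that for all $n$ and all holomorphic polynomials $Q_n$ of degree at most $n$, $\|Q_n\|_E\le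 M(1+\epsilon)^n\|Q_n\|_{L^2(\mu)}$, where $\|\cdot\|_E$ is the sup norm on $E$. *)

(* Defs.v *)
From HB Require Import structures.
From mathcomp Require Import all_boot all_order all_algebra.
From mathcomp Require Import all_classical all_reals all_analysis.
From mathcomp Require Import complex.
(* The notations of mpoly clash with those of mathcomp-analysis. *)
From mathcomp Require Import -(notations) mpoly.

Set Implicit Arguments.
Unset Strict Implicit.
Unset Printing Implicit Defensive.

Import Order.TTheory GRing.Theory Num.Theory.
Import numFieldNormedType.Exports.

Local Open Scope classical_set_scope.
Local Open Scope ring_scope.
Local Open Scope complex_scope.

(* R[i]^o rather than R[i], because only the former carries a topology (the one
   given by the modulus). *)
Definition Cspace (R : realType) (N : nat) := 'rV[R[i]^o]_N.

Definition borelCspace (R : realType) (N : nat) :=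
  g_sigma_algebraType (@open (Cspace R N)).

Definition coords (R : realType) (N : nat) (z : Cspace R N) (k : 'I_N) : R[i] :=
  z ord0 k.

(* The norm of R[i] itself is R[i]-valued; that of Rcomplex R is R-valued. *)
Definition cmod (R : realType) (c : R[i]) : R := `|c : Rcomplex R|.

(* The order of multinom compares total degrees first and then exponents
   lexicographically, so a listing is nondecreasing in degree. It is indexed from
   0, whereas monomials are usually numbered from 1: e_(i+1)(z) = z^(alpha i). *)
Definition deglex_listing (N : nat) (alpha : nat -> multinom N) : Prop :=
  (forall m : multinom N, exists i, alpha i = m) /\
  (forall i j, (i < j)%N -> (alpha i < alpha j)%O).

Definition monomial_at (R : realType) (N : nat) (a : multinom N)
  (z : Cspace R N) : R[i] := mmap1 (coords z) a.

Definition num_monomials (N d : nat) : nat := 'C(N + d, d).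

Definition sum_degrees (N d : nat) : nat := (N * 'C(N + d, N.+1))%N.

Definition VDM (R : realType) (N : nat) (alpha : nat -> multinom N)
    (n : nat) (zeta : 'I_n -> Cspace R N) : R[i] :=
  \det (\matrix_(i < n, j < n) monomial_at (alpha i) (zeta j)).

(* On a nonempty compact set E the supremum is a maximum; it is 0 for E = set0. *)
Definition max_VDM (R : realType) (N : nat) (alpha : nat -> multinom N)
    (E : set (Cspace R N)) (n : nat) : R :=
  sup [set cmod (VDM alpha zeta)
      | zeta in [set zeta : 'I_n -> Cspace R N | forall j, E (zeta j)]].

Definition transfinite_diameter (R : realType) (N : nat)
    (alpha : nat -> multinom N) (E : set (Cspace R N)) : R :=
  limn (fun d => max_VDM alpha E (num_monomials N d) `^ (sum_degrees N d)%:R^-1).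

Definition poly_at (R : realType) (N : nat) (Q : mpoly N R[i])
  (z : Cspace R N) : R[i] := meval (coords z) Q.

Definition sup_norm (R : realType) (N : nat) (E : set (Cspace R N))
    (f : Cspace R N -> R[i]) : R := sup [set cmod (f z) | z in E].

(* msize is 1 + the degree, and 0 for the zero polynomial. *)
Definition Bernstein_Markov (R : realType) (N : nat) (E : set (Cspace R N))
    (mu : {measure set (borelCspace R N) -> \bar R}) : Prop :=
  forall eps : R, 0 < eps -> exists M : R,
  forall (n : nat) (Q : mpoly N R[i]), (msize Q <= n.+1)%N ->
    ((sup_norm E (poly_at Q))%:E <=
     (M * (1 + eps) ^+ n)%:E * 'N[mu]_2%:E[EFin \o (fun z => cmod (poly_at Q z))])%E.

(* \int_A ... \int_A f(x_1, ..., x_n) dmu(x_n) ... dmu(x_1); this is the integral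
   over A^n by Tonelli's theorem. *)
Fixpoint iterated_integral (d : measure_display) (T : measurableType d)
    (R : realType) (mu : {measure set T -> \bar R}) (A : set T) (n : nat) :
    (n.-tuple T -> \bar R) -> \bar R :=
  if n is n'.+1 then fun f => (\int[mu]_(x in A)
    iterated_integral mu A (fun t : n'.-tuple T => f [tuple of x :: t]))%E
  else fun f => f [tuple].

Definition Z_ (R : realType) (N : nat) (alpha : nat -> multinom N)
    (E : set (Cspace R N)) (mu : {measure set (borelCspace R N) -> \bar R})
    (d : nat) : \bar R :=
  iterated_integral mu E
    (fun t : (num_monomials N d).-tuple (borelCspace R N) =>
       (cmod (VDM alpha (tnth t)) ^+ 2)%:E).

(* Main.v *)
(* Write V_n for the maximal Vandermonde modulus of n points of E and T(a) for the
   Chebyshev constant of a multi-index a, the infimum of the sup norms over E of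
   the polynomials z^a + (lower terms). Expanding the determinant along a row or a
   column gives T(alpha n) V_n <= V_(n+1) <= (n+1) T(alpha n) V_n, so that V_n is
   prod_(i < n) T(alpha i) up to a factor n!, and n! disappears in the limit.

   The existence of the transfinite diameter follows from the submultiplicativity
   of T. Adding a slack variable, the multi-indices of degree at most d in N
   variables become those of degree exactly d in N+1 variables. A Polya urn couples
   the uniform laws on the multi-indices of degrees j and k so that their sum is
   uniform in degree j + k; hence the mean of ln T over degree at most d is
   subadditive in d, and Fekete's lemma applies, as l_d = N d m_d / (N+1).

   For Z_d, integrating |VDM|^2 <= V^2 gives Z_d <= V^2 mu(E)^(m_d), and the
   Bernstein-Markov inequality used in one point after the other gives
   V^2 <= (M (1+eps)^d)^(2 m_d) Z_d. Taking roots of order 2 l_d leaves a factor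
   tending to 1 in the first case and at most (1+eps)^2 in the second. *)

Require Import Defs.
From HB Require Import structures.
From mathcomp Require Import all_boot all_order all_algebra.
From mathcomp Require Import all_classical all_reals all_analysis.
From mathcomp Require Import complex.
From mathcomp Require Import -(notations) mpoly.
From mathcomp Require Import measurable_realfun.
From mathcomp Require Import zify ring lra.

Set Implicit Arguments.
Unset Strict Implicit.
Unset Printing Implicit Defensive.

Import Order.TTheory GRing.Theory Num.Theory.
Import numFieldNormedType.Exports.

Local Open Scope classical_set_scope.
Local Open Scope ring_scope.

(** * Multi-indices of given degree and the Polya urn *)

Section HomogeneousMonomials.
Variable n : nat.
Implicit Types (a b c g : multinom n).

Definition mnms_of_deg d : seq (multinom n) :=
  map (@bmnm n d.+1) [seq m <- enum {: bmultinom n d.+1} | mdeg (bmnm m) == d].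

Lemma mem_mnms_of_deg d a : (a \in mnms_of_deg d) = (mdeg a == d).
Proof.
apply/mapP/idP => [[m]|/eqP da]; first by rewrite mem_filter => /andP[m_d _] ->.
have lt_a : (mdeg a < d.+1)%N by rewrite da.
by exists (BMultinom lt_a); rewrite // mem_filter /= da eqxx mem_enum.
Qed.

Lemma mnms_of_deg_uniq d : uniq (mnms_of_deg d).
Proof. by rewrite (map_inj_uniq val_inj) filter_uniq// enum_uniq. Qed.

Lemma mnms_of_deg0 : perm_eq (mnms_of_deg 0) [:: mnm0].
Proof.
apply: uniq_perm => //; first exact: mnms_of_deg_uniq.
by move=> a; rewrite mem_mnms_of_deg mdeg_eq0 inE.
Qed.

(** Translation by [c] is a bijection onto the multi-indices of degree [j + mdeg c] that dominate
    [c]. *)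
Lemma sum_mnms_shift (V : nmodType) (G : multinom n -> V) c j :
  \sum_(a <- mnms_of_deg j) G (mnm_add a c) =
  \sum_(g <- mnms_of_deg (j + mdeg c) | lem c g) G g.
Proof.
rewrite -[RHS]big_filter -[LHS](big_map (mnm_add^~ c) xpredT G).
apply: perm_big; apply: uniq_perm.
- by rewrite map_inj_uniq ?mnms_of_deg_uniq//; exact: addIm.
- by rewrite filter_uniq// mnms_of_deg_uniq.
move=> g; rewrite mem_filter mem_mnms_of_deg; apply/mapP/andP.
  move=> [a]; rewrite mem_mnms_of_deg => /eqP <- ->.
  by rewrite mdegD lem_addl.
move=> [cg /eqP dg]; exists (mnm_sub g c); last by rewrite submK.
by rewrite mem_mnms_of_deg -(eqn_add2r (mdeg c)) -mdegD submK// dg.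
Qed.

(** Terms with [a x = 0] drop out, and the others are translates by the unit multi-index of [x].
    This drives the induction on the degree in [sum_prod_bin] and [sum_polya_weight]. *)
Lemma sum_mnms_succ (G : multinom n -> nat) (x : 'I_n) j :
  (\sum_(a <- mnms_of_deg j.+1) a x * G a =
   \sum_(a <- mnms_of_deg j) (a x).+1 * G (mnm_add a (mnm1 x)))%N.
Proof.
transitivity (\sum_(a <- mnms_of_deg (j + mdeg (mnm1 x)) | lem (mnm1 x) a)
    a x * G a)%N.
  rewrite mdeg1 addn1 [RHS]big_mkcond /=; apply: eq_bigr => a _.
  by rewrite lep1mP; case: (a x) => //=; rewrite mul0n.
rewrite -(sum_mnms_shift (fun a => a x * G a)%N) /=; apply: eq_bigr => a _.
by rewrite mnmDE mnm1E eqxx addn1.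
Qed.

(** Vandermonde's convolution: choosing [j] objects from boxes of sizes [g i]. The induction marks
    one chosen object: [j.+1] is the sum of the [a x], and absorption removes the marked object from
    box [x]. *)
Lemma sum_prod_bin g j :
  (\sum_(a <- mnms_of_deg j) \prod_i 'C(g i, a i) = 'C(mdeg g, j))%N.
Proof.
elim: j g => [|j IHj] g.
  rewrite (perm_big _ mnms_of_deg0) big_seq1 bin0 big1// => i _.
  by rewrite mnm0E bin0.
apply/eqP; rewrite -(eqn_pmul2l (ltn0Sn j)) -mul_bin_diag; apply/eqP.
transitivity (\sum_x \sum_(a <- mnms_of_deg j.+1)
    a x * \prod_i 'C(g i, a i))%N.
  rewrite exchange_big big_distrr /= big_seq [RHS]big_seq.
  apply: eq_bigr => a; rewrite mem_mnms_of_deg => /eqP <-.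
  by rewrite mdegE big_distrl.
rewrite mdegE big_distrl /=; apply: eq_bigr => x _.
rewrite (sum_mnms_succ (fun a => \prod_i 'C(g i, a i))%N).
transitivity (g x * \sum_(a <- mnms_of_deg j)
    \prod_i 'C(mnm_sub g (mnm1 x) i, a i))%N.
  rewrite big_distrr /=; apply: eq_bigr => a _.
  rewrite (bigD1 x)//= [in RHS](bigD1 x)//= !mulnA; congr (_ * _)%N.
    by rewrite mnmDE mnmBE mnm1E eqxx addn1 subn1 -mul_bin_diag.
  apply: eq_bigr => i ix.
  by rewrite mnmDE mnmBE mnm1E eq_sym (negbTE ix) addn0 subn0.
(* If [g x = 0], the truncated subtraction does not lower the degree, but both sides carry the
   factor [g x]. *)
rewrite IHj; have [->|gx] := eqVneq (g x) 0%N; first by rewrite !mul0n.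
congr (_ * 'C(_, _))%N; rewrite -mdegE.
have := submK (_ : lem (mnm1 x) g); rewrite lep1mP gx => /(_ isT).
by move/(congr1 (@mdeg n)); rewrite mdegD mdeg1 addn1 => <-.
Qed.

End HomogeneousMonomials.

(** Both sides are the trinomial coefficient of [p], [q], [r]. *)
Lemma bin_trinomial p q r :
  ('C(p + q + r, r) * 'C(p + q, q) = 'C(q + r, q) * 'C(p + (q + r), q + r))%N.
Proof.
have binE a b : ('C(a + b, b) * (a`! * b`!) = (a + b)`!)%N.
  by rewrite [(a`! * _)%N]mulnC -[X in (_ * (_ * X`!))%N](addnK b) bin_fact// leq_addl.
have pos : (0 < p`! * q`! * r`!)%N by rewrite !muln_gt0 !fact_gt0.
apply/eqP; rewrite -(eqn_pmul2r pos); apply/eqP.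
transitivity ((p + q + r)`!)%N.
  by rewrite -(binE (p + q)%N) -(binE p); lia.
rewrite -addnA -(binE p (q + r)%N) (addnC q r).
by rewrite -(binE r); lia.
Qed.

Section PolyaUrn.
Variable N : nat.
Implicit Types (a b c g : multinom N.+1).

Definition polya_weight a b : nat := (\prod_i 'C(a i + b i, a i))%N.

Lemma polya_weightC a b : polya_weight a b = polya_weight b a.
Proof.
by apply: eq_bigr => i _; rewrite -bin_sub ?leq_addr// addKn addnC.
Qed.

(** The coefficient of t^k in the product over [i] of (1-t)^-(a i + 1), which is (1-t)^-(|a| + N +
    1). The proof is again by marking: [k.+1] is split as the sum of the [b x]. *)
Lemma sum_polya_weight a k :
  (\sum_(b <- mnms_of_deg N.+1 k) polya_weight a b = 'C(mdeg a + k + N, k))%N.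
Proof.
elim: k => [|k IHk].
  rewrite (perm_big _ (mnms_of_deg0 N.+1)) big_seq1 bin0.
  by apply: big1 => i _; rewrite mnm0E addn0 binn.
apply/eqP; rewrite -(eqn_pmul2l (ltn0Sn k)) -mul_bin_diag; apply/eqP.
transitivity (\sum_x \sum_(b <- mnms_of_deg N.+1 k.+1)
    b x * polya_weight a b)%N.
  rewrite exchange_big big_distrr /= big_seq [RHS]big_seq.
  apply: eq_bigr => b; rewrite mem_mnms_of_deg => /eqP <-.
  by rewrite mdegE big_distrl.
under eq_bigr do rewrite sum_mnms_succ.
rewrite exchange_big /= addnS addSn /= -IHk big_distrr /=.
rewrite big_seq [RHS]big_seq; apply: eq_bigr => b.
rewrite mem_mnms_of_deg => /eqP <-.
transitivity (\sum_x (a x + b x).+1 * polya_weight a b)%N.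
  apply: eq_bigr => x _; rewrite /polya_weight.
  rewrite (bigD1 x)//= [in RHS](bigD1 x)//= !mulnA; congr (_ * _)%N.
    rewrite mnmDE mnm1E eqxx addn1 addnS.
    by rewrite (mul_bin_down (a x + b x).+1) subSn ?leq_addr// addKn.
  by apply: eq_bigr => i ix; rewrite mnmDE mnm1E eq_sym (negbTE ix) addn0.
rewrite -big_distrl /=; congr (_ * _)%N.
under eq_bigr do rewrite -addn1.
by rewrite !big_split /= sum1_card card_ord !mdegE addnS.
Qed.

Lemma size_mnms_of_deg d : size (mnms_of_deg N.+1 d) = 'C(N + d, d).
Proof.
have := sum_polya_weight mnm0 d.
rewrite mdeg0 add0n addnC => <-.
rewrite (eq_bigr (fun=> 1%N)) ?sum1_size// => b _.
by apply: big1 => i _; rewrite mnm0E bin0.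
Qed.

(* The counts of the first [j] and of the last [k] draws from a Polya urn
   (started with one ball of each of [N + 1] colours) are uniform on the
   multi-indices of degree [j] and [k], and their sum is uniform on those of
   degree [j + k]; [polya_weight] is, up to normalisation, their joint law. *)
Lemma polya_coupling (R : realFieldType) (f : multinom N.+1 -> R) j k :
  (forall a b, f (mnm_add a b) <= f a + f b) ->
  'C(j + k, j)%:R * \sum_(g <- mnms_of_deg N.+1 (j + k)) f g <=
  'C(j + k + N, k)%:R * \sum_(a <- mnms_of_deg N.+1 j) f a +
  'C(j + k + N, j)%:R * \sum_(b <- mnms_of_deg N.+1 k) f b.
Proof.
move=> fD.
have -> : 'C(j + k, j)%:R * \sum_(g <- mnms_of_deg N.+1 (j + k)) f g =
  \sum_(a <- mnms_of_deg N.+1 j) \sum_(b <- mnms_of_deg N.+1 k)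
    (polya_weight a b)%:R * f (mnm_add b a).
  transitivity (\sum_(a <- mnms_of_deg N.+1 j) \sum_(g <- mnms_of_deg N.+1 (j + k))
    (\prod_i 'C(g i, a i))%:R * f g).
    rewrite exchange_big mulr_sumr big_seq [RHS]big_seq; apply: eq_bigr => g.
    rewrite mem_mnms_of_deg => /eqP <-.
    by rewrite -(sum_prod_bin g) natr_sum mulr_suml.
  rewrite big_seq [RHS]big_seq; apply: eq_bigr => a.
  rewrite mem_mnms_of_deg => /eqP <-.
  transitivity (\sum_(b <- mnms_of_deg N.+1 k)
     (\prod_i 'C((mnm_add b a) i, a i))%:R * f (mnm_add b a)).
    rewrite (sum_mnms_shift (fun g => (\prod_i 'C(g i, a i))%:R * f g)).
    rewrite addnC [RHS]big_mkcond /=; apply: eq_bigr => g _.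
    (* If [a] is not below [g], one of the binomial factors vanishes. *)
    case: ifPn => //= /mnm_lepP/existsNP[i /negP]; rewrite -ltnNge => gi.
    by rewrite (bigD1 i)//= bin_small// mul0n mul0r.
  apply: eq_bigr => b _; congr (_%:R * _); apply: eq_bigr => i _.
  by rewrite mnmDE addnC.
have -> : 'C(j + k + N, k)%:R * \sum_(a <- mnms_of_deg N.+1 j) f a =
  \sum_(a <- mnms_of_deg N.+1 j) \sum_(b <- mnms_of_deg N.+1 k)
    (polya_weight a b)%:R * f a.
  rewrite mulr_sumr big_seq [RHS]big_seq; apply: eq_bigr => a.
  rewrite mem_mnms_of_deg => /eqP <-.
  by rewrite -sum_polya_weight natr_sum mulr_suml.
have -> : 'C(j + k + N, j)%:R * \sum_(b <- mnms_of_deg N.+1 k) f b =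
  \sum_(a <- mnms_of_deg N.+1 j) \sum_(b <- mnms_of_deg N.+1 k)
    (polya_weight a b)%:R * f b.
  rewrite exchange_big mulr_sumr big_seq [RHS]big_seq; apply: eq_bigr => b.
  rewrite mem_mnms_of_deg => /eqP <-.
  rewrite [X in (X + N)%N]addnC -sum_polya_weight natr_sum mulr_suml.
  by apply: eq_bigr => a _; rewrite polya_weightC.
rewrite -big_split /=; apply: ler_sum => a _.
rewrite -big_split /=; apply: ler_sum => b _.
by rewrite -mulrDr ler_wpM2l// addrC fD.
Qed.

Definition mnms_mean (R : fieldType) (f : multinom N.+1 -> R) d : R :=
  (\sum_(a <- mnms_of_deg N.+1 d) f a) / 'C(N + d, d)%:R.

(** This is [polya_coupling] divided by ['C(j + k, j) * 'C(N + (j + k), j + k)]; by [bin_trinomial]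
    every coefficient becomes the reciprocal of a number of multi-indices. *)
Lemma mnms_mean_subadditive (R : realFieldType) (f : multinom N.+1 -> R) j k :
  (forall a b, f (mnm_add a b) <= f a + f b) ->
  mnms_mean f (j + k) <= mnms_mean f j + mnms_mean f k.
Proof.
move=> fD.
have bin_neq0 p q : ('C(p + q, q))%:R != 0 :> R.
  by rewrite pnatr_eq0 -lt0n bin_gt0 leq_addl.
have pos : 0 < ('C(j + k, j) * 'C(N + (j + k), j + k))%:R :> R.
  by rewrite ltr0n muln_gt0 !bin_gt0 leq_addr leq_addl.
have e1 : (j + k + N = N + j + k)%N by lia.
have e2 : 'C(N + j + k, j) = 'C(N + k + j, j) by congr 'C(_, _); lia.
have e3 : ('C(N + k + j, j) * 'C(N + k, k) = 'C(j + k, j) * 'C(N + (j + k), j + k))%N.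
  by rewrite bin_trinomial (addnC k j) -(bin_sub (leq_addr k j)) addKn.
have := polya_coupling j k fD; rewrite e1 e2 => le.
rewrite -(ler_pM2l pos) mulrDr /mnms_mean.
rewrite [X in X * _ <= _]natrM -mulrA [X in _ * X <= _]mulrC mulfVK//.
rewrite -[in X in _ <= X + _]bin_trinomial -e3 !natrM.
by rewrite -!mulrA ![_ * (_ / _)]mulrC !mulfVK.
Qed.

End PolyaUrn.

(** * Fekete's lemma *)

Section Fekete.
Variables (R : realType) (g : nat -> R).
Hypothesis gD : forall j k, g (j + k)%N <= g j + g k.

(** With [m = q n + r] and [r < n], subadditivity gives g(m) <= q g(n) + g(r). In [H], the sum
    bounds g(r) and |g(n)| bounds the error of replacing [q] by [m / n]. *)
Lemma subadditive_mean_le n : (0 < n)%N ->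
  exists H, forall m, (0 < m)%N -> g m / m%:R <= g n / n%:R + H / m%:R.
Proof.
move=> n0; exists (`|g n| + \sum_(r < n) `|g r|) => m m0.
have gM q r : g (q * n + r)%N <= q%:R * g n + g r.
  elim: q => [|q IHq]; first by rewrite mul0r add0r.
  rewrite mulSn -addnA (le_trans (gD _ _))// -natr1 mulrDl mul1r.
  by rewrite [q%:R * _ + _]addrC -addrA lerD2l.
have m_gt0 : 0 < m%:R :> R by rewrite ltr0n.
have n_gt0 : 0 < n%:R :> R by rewrite ltr0n.
have gr : g (m %% n)%N <= \sum_(r < n) `|g r|.
  rewrite (le_trans (ler_norm _))// (bigD1 (Ordinal (ltn_pmod m n0)))//=.
  by rewrite lerDl sumr_ge0.
rewrite -(ler_pM2r m_gt0) mulrDl !mulfVK ?gt_eqF//.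
rewrite {1}(divn_eq m n) (le_trans (gM _ _))// addrA lerD//.
rewrite {2}(divn_eq m n) natrD natrM mulrDr [_ * n%:R]mulrC mulrA mulfVK ?gt_eqF//.
rewrite [leLHS]mulrC -addrA lerDl -lerBlDl sub0r.
rewrite (le_trans (ler_norm _))// normrN !normrM normfV !normr_nat -mulrA.
rewrite ler_piMr// mulrC ler_pdivrMr// mul1r ler_nat.
exact/ltnW/ltn_pmod.
Qed.

(** The means [g n / n] may tend to minus infinity; their exponentials then tend to 0, so a real
    limit exists in every case. It is the infimum over positive [n]. *)
Lemma fekete_expR : exists L : R, expR (g n / n%:R) @[n --> \oo] --> L.
Proof.
pose u n := expR (g n / n%:R).
pose L := inf [set u n | n in [set n | (0 < n)%N]].
have lbU : has_lbound [set u n | n in [set n | (0 < n)%N]].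
  by exists 0 => _ [n _ <-]; exact: expR_ge0.
have infU : has_inf [set u n | n in [set n | (0 < n)%N]].
  by split => //; exists (u 1%N), 1%N.
exists L; apply/cvgrPdist_lt => e e0.
have [_ [n /= n0 <-] un] := inf_adherent e0 infU.
have [H gH] := subadditive_mean_le n0.
have cvgH0 : H / m%:R @[m --> \oo] --> 0.
  rewrite -(mulr0 H); apply: cvgMr.
  by rewrite -(cvg_shiftS (fun m => m%:R^-1 : R)); exact: cvg_harmonic.
have cvgH : u n * expR (H / m%:R) @[m --> \oo] --> u n.
  rewrite -[X in _ --> X]mulr1; apply: cvgMr; rewrite -[X in _ --> X]expR0.
  by apply: continuous_cvg cvgH0; exact: continuous_expR.
near=> m.
have m0 : (0 < m)%N by near: m; exists 1%N.
have Lu : L <= u m by apply: ge_inf => //; exists m.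
rewrite ler0_norm ?subr_le0// opprB ltrBlDl.
apply: (@le_lt_trans _ _ (u n * expR (H / m%:R))).
  by rewrite -expRD ler_expR gH.
near: m; apply: (cvgr_lt (u n)); [exact: cvgH|exact: un].
Unshelve. all: by end_near. Qed.

End Fekete.

(** * Polynomial maps and sup norms *)

Section Modulus.
Variable R : realType.
Implicit Types c : R[i].

Lemma normr_cmod c : `|c| = (cmod c)%:C%C. Proof. by case: c. Qed.

Lemma cmod_ge0 c : 0 <= cmod c. Proof. exact: normr_ge0. Qed.

Lemma cmod0 : cmod 0 = 0 :> R. Proof. exact: (@normr0 R (Rcomplex R)). Qed.

Lemma cmod1 : cmod 1 = 1 :> R. Proof. exact: ComplexField.Normc.normc1. Qed.

Lemma cmodM c1 c2 : cmod (c1 * c2) = cmod c1 * cmod c2.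
Proof. exact: ComplexField.Normc.normcM. Qed.

Lemma cmod_eq0 c : (cmod c == 0) = (c == 0).
Proof. exact: (@normr_eq0 R (Rcomplex R)). Qed.

Lemma cmod_sign n : cmod ((-1) ^+ n : R[i]) = 1.
Proof.
elim: n => [|n IHn]; first exact: cmod1.
by rewrite exprS cmodM IHn mulr1 -[RHS]cmod1; exact: (@normrN R (Rcomplex R)).
Qed.

Lemma cmod_sum (I : Type) (r : seq I) (F : I -> R[i]) :
  cmod (\sum_(i <- r) F i) <= \sum_(i <- r) cmod (F i).
Proof. exact: (@ler_norm_sum R (Rcomplex R)). Qed.

Lemma continuous_cmod : continuous (fun c : R[i]^o => cmod c).
Proof.
move=> c A /nbhs_ballP[e e0 eA]; exists (e%:C)%C; first by rewrite /= ltcR.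
move=> c' cc'; apply: eA; rewrite /ball /=.
apply: (@le_lt_trans _ _ (cmod (c - c'))); first exact: (@ler_dist_dist R (Rcomplex R)).
by move: cc'; rewrite /ball_ /= normr_cmod ltcR.
Qed.

End Modulus.

Section PolynomialMaps.
Variables (R : realType) (N : nat).
Implicit Types (Q : mpoly N R[i]) (z : Cspace R N).

Lemma continuous_monomial_at (a : multinom N) :
  continuous (monomial_at a : Cspace R N -> R[i]^o).
Proof.
rewrite /monomial_at /mmap1; elim: (index_enum _) => [|i s IHs].
  by under eq_fun do rewrite big_nil; exact: cst_continuous.
under eq_fun do rewrite big_cons; move=> z.
apply: (@cvgM R[i] _ _ _ (fun z => coords z i ^+ a i) _ _ _ _ (IHs z)).
elim: (a i) => [|k IHk]; first exact: (@cvg_cst R[i]^o).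
under eq_fun do rewrite exprS; rewrite exprS.
by apply: (@cvgM R[i] _ _ _ (fun z => coords z i) _ _ _ _ IHk); exact: coord_continuous.
Qed.

Lemma continuous_poly_at Q : continuous (poly_at Q : Cspace R N -> R[i]^o).
Proof.
rewrite /poly_at /meval /mmap; elim: (msupp Q) => [|m r IHr].
  by under eq_fun do rewrite big_nil; exact: cst_continuous.
under eq_fun do rewrite big_cons; move=> z.
apply: (@cvgD _ R[i]^o _ _ _ (fun z => mcoeff m Q * monomial_at m z)) (IHr z).
by apply: (@cvgMr R[i]); exact: continuous_monomial_at.
Qed.

Lemma continuous_cmod_poly_at Q : continuous (fun z => cmod (poly_at Q z)).
Proof.
move=> z; apply: (@continuous_comp (Cspace R N) R[i]^o R (poly_at Q) (@cmod R)).
  exact: continuous_poly_at.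
exact: continuous_cmod.
Qed.

Lemma Cspace_hausdorff : hausdorff_space (Cspace R N).
Proof. exact: norm_hausdorff. Qed.

Lemma poly_atM (P Q : mpoly N R[i]) z : poly_at (P * Q) z = poly_at P z * poly_at Q z.
Proof. exact: mevalM. Qed.
Lemma poly_atZ c Q z : poly_at (c *: Q) z = c * poly_at Q z.
Proof. exact: mevalZ. Qed.
Lemma poly_atX (a : multinom N) z : poly_at (mpolyX _ a) z = monomial_at a z.
Proof. exact: mevalX. Qed.
Lemma poly_at_sum (I : Type) (r : seq I) (F : I -> mpoly N R[i]) z :
  poly_at (\sum_(i <- r) F i) z = \sum_(i <- r) poly_at (F i) z.
Proof. exact: raddf_sum. Qed.
End PolynomialMaps.

Section SupNorm.
Variables (R : realType) (N : nat) (E : set (Cspace R N)).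
Implicit Types (Q : mpoly N R[i]) (z : Cspace R N).

Lemma sup_norm_ge0 (f : Cspace R N -> R[i]) : 0 <= sup_norm E f.
Proof.
rewrite /sup_norm; set S := [set _ | _ in _].
(* A set without a supremum has [sup] equal to 0. *)
have [[S0 ubS]|/sup_out ->//] := pselect (has_sup S).
have [_ [z Ez _]] := S0.
by apply: le_trans (cmod_ge0 (f z)) _; apply: ub_le_sup => //; exists z.
Qed.

Lemma sup_norm_le (f : Cspace R N -> R[i]) c : 0 <= c ->
  (forall z, E z -> cmod (f z) <= c) -> sup_norm E f <= c.
Proof.
move=> c0 fc; rewrite /sup_norm; set S := [set _ | _ in _].
have [->|/set0P S0] := eqVneq S set0; first by rewrite sup0.
by apply: ge_sup => // _ [z Ez <-]; exact: fc.
Qed.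

Hypothesis cE : compact E.

Lemma le_sup_norm Q z : E z -> cmod (poly_at Q z) <= sup_norm E (poly_at Q).
Proof.
move=> Ez; apply: ub_le_sup; last by exists z.
have : compact [set cmod (poly_at Q z) | z in E].
  by apply: continuous_compact => //; apply/continuous_subspaceT/continuous_cmod_poly_at.
move=> /compact_bounded[M [_ MS]]; exists (M + 1) => r Sr.
by apply: le_trans (ler_norm r) _; apply: MS Sr; rewrite ltrDl.
Qed.

End SupNorm.

(** * Chebyshev constants and Vandermonde determinants *)

Section ChebyshevConstants.
Variables (R : realType) (N : nat) (E : set (Cspace R N)).
Implicit Types (Q : mpoly N R[i]) (z : Cspace R N) (a b : multinom N).

Definition monic_of_lead a : set (mpoly N R[i]) :=
  [set Q | mcoeff a Q = 1 /\ forall m, m \in msupp Q -> (m <= a)%O].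

Definition cheb a : R := inf [set sup_norm E (poly_at Q) | Q in monic_of_lead a].

Lemma monic_of_lead_mpolyX a : monic_of_lead a (mpolyX _ a).
Proof.
split; first by rewrite mcoeffX eqxx.
by move=> m; rewrite msuppX inE => /eqP ->.
Qed.

Lemma mlead_monic a Q : monic_of_lead a Q -> mlead Q = a.
Proof.
move=> [Qa Q_le].
have aQ : a \in msupp Q by rewrite mcoeff_msupp Qa oner_eq0.
have Q0 : Q != 0 by apply: contraTneq aQ => ->; rewrite msupp0.
by apply/le_anti; rewrite Q_le ?mlead_supp//= msupp_le_mlead.
Qed.

Lemma monic_of_leadM a b P Q : monic_of_lead a P -> monic_of_lead b Q ->
  monic_of_lead (mnm_add a b) (P * Q).
Proof.
move=> aP bQ; have [Pa _] := aP; have [Qb _] := bQ; split.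
  by rewrite -(mlead_monic aP) -(mlead_monic bQ) mleadcM
    (mlead_monic aP) (mlead_monic bQ) Pa Qb mulr1.
move=> m /msupp_le_mlead /le_trans; apply.
by rewrite -(mlead_monic aP) -(mlead_monic bQ) mleadM_le.
Qed.

Lemma cheb_glb a c :
  (forall Q, monic_of_lead a Q -> c <= sup_norm E (poly_at Q)) -> c <= cheb a.
Proof.
move=> cQ; apply: lb_le_inf; last by move=> _ [Q /cQ cle <-].
by exists (sup_norm E (poly_at (mpolyX _ a))), (mpolyX _ a) => //; exact: monic_of_lead_mpolyX.
Qed.

Lemma cheb_le a Q : monic_of_lead a Q -> cheb a <= sup_norm E (poly_at Q).
Proof.
move=> aQ; apply: ge_inf; last by exists Q.
by exists 0 => _ [P _ <-]; exact: sup_norm_ge0.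
Qed.

Lemma cheb_ge0 a : 0 <= cheb a.
Proof. by apply: cheb_glb => Q _; exact: sup_norm_ge0. Qed.

Lemma cheb_glbM a c k : 0 <= k ->
  (forall Q, monic_of_lead a Q -> c <= k * sup_norm E (poly_at Q)) ->
  c <= k * cheb a.
Proof.
rewrite le_eqVlt => /predU1P[<- cQ|k0 cQ].
  by have := cQ _ (monic_of_lead_mpolyX a); rewrite !mul0r.
rewrite mulrC -ler_pdivrMr//; apply: cheb_glb => Q aQ.
by rewrite ler_pdivrMr// mulrC; exact: cQ.
Qed.

Hypothesis cE : compact E.

(** A product of competitors for [a] and [b] competes for the sum, and sup norms are
    submultiplicative; the two infima are taken one after the other. *)
Lemma chebD a b : cheb (mnm_add a b) <= cheb a * cheb b.
Proof.
apply: cheb_glbM => [|Q bQ]; first exact: cheb_ge0.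
rewrite mulrC; apply: cheb_glbM => [|P aP]; first exact: sup_norm_ge0.
apply: le_trans (cheb_le (monic_of_leadM aP bQ)) _.
apply: sup_norm_le => [|z Ez]; first by rewrite mulr_ge0// sup_norm_ge0.
by rewrite poly_atM cmodM mulrC ler_pM ?cmod_ge0// le_sup_norm.
Qed.

End ChebyshevConstants.

Section Vandermonde.
Variables (R : realType) (N : nat) (alpha : nat -> multinom N).
Hypothesis halpha : deglex_listing alpha.
Implicit Types (Q : mpoly N R[i]) (z : Cspace R N).

Lemma listing_lt i j : (alpha i < alpha j)%O = (i < j)%N.
Proof.
have [_ inc] := halpha; case: (ltngtP i j) => [/inc//|/inc/lt_gtF//|->].
by rewrite ltxx.
Qed.

Lemma listing_inj : injective alpha.
Proof.
move=> i j eq_ij; case: (ltngtP i j) => //; rewrite -listing_lt eq_ij ltxx//.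
Qed.

Lemma listing_le i j : (alpha i <= alpha j)%O = (i <= j)%N.
Proof. by rewrite leNgt listing_lt -leqNgt. Qed.

(** Adding multiples of earlier rows to the last one turns its monomial into [Q] without changing
    the determinant. In terms of cofactors: row [i] paired with the cofactors of the last row gives
    the determinant if [i] is the last row and 0 otherwise. *)
Lemma VDM_row_expansion n Q (zeta : 'I_n.+1 -> Cspace R N) :
  monic_of_lead (alpha n) Q ->
  VDM alpha zeta = \sum_j poly_at Q (zeta j) *
    ((-1) ^+ (n + j) * VDM alpha (zeta \o lift j)).
Proof.
move=> [Qn Q_le]; pose M := \matrix_(i < n.+1, j < n.+1) monomial_at (alpha i) (zeta j).
have cofE (j : 'I_n.+1) : (-1) ^+ (n + j) * VDM alpha (zeta \o lift j) = cofactor M ord_max j.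
  congr (_ * \det _); apply/matrixP => i k; rewrite !mxE /=.
  by rewrite /bump leqNgt ltn_ord add0n.
have adjE (i : 'I_n.+1) : \sum_j monomial_at (alpha i) (zeta j) * cofactor M ord_max j =
    VDM alpha zeta *+ (i == ord_max).
  have := congr1 (fun A => fun_of_matrix A i ord_max) (mul_mx_adj M).
  rewrite !mxE => <-; apply: eq_bigr => j _.
  by rewrite !mxE.
under eq_bigr do rewrite cofE /poly_at mevalE mulr_suml.
rewrite exchange_big /= (bigD1_seq (alpha n)) ?msupp_uniq//=; last first.
  by rewrite mcoeff_msupp Qn oner_eq0.
rewrite [X in _ = _ + X]big1_seq ?addr0 => [|m /andP[mn mQ]].
  rewrite Qn; under eq_bigr do rewrite mul1r.
  by have := adjE ord_max; rewrite eqxx => ->.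
(* A lower monomial of [Q] is listed before [alpha n], hence is an earlier row and contributes 0. *)
have [i mi] := halpha.1 m.
have le_in : (i <= n)%N by rewrite -listing_le mi Q_le.
under eq_bigr do rewrite -mulrA; rewrite -mulr_sumr -mi.
have := adjE (Ordinal (le_in : (i < n.+1)%N)) => ->.
suff /negbTE -> : Ordinal (le_in : (i < n.+1)%N) != ord_max by rewrite mulr0n mulr0.
by apply: contraNneq mn => /(congr1 val)/= <-; rewrite mi.
Qed.

(** The determinant as a polynomial in its [j]-th point, expanded along column [j]; [zeta] holds the
    other [n] points. *)
Definition VDM_poly n (j : 'I_n.+1) (zeta : 'I_n -> Cspace R N) : mpoly N R[i] :=
  \sum_(i < n.+1) ((-1) ^+ (i + j) *
    \det (\matrix_(k < n, l < n) monomial_at (alpha (lift i k)) (zeta l)))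
    *: mpolyX _ (alpha i).

Lemma VDM_polyE n (j : 'I_n.+1) (zeta : 'I_n.+1 -> Cspace R N) :
  VDM alpha zeta = poly_at (VDM_poly j (zeta \o lift j)) (zeta j).
Proof.
rewrite /VDM (expand_det_col _ j) /VDM_poly poly_at_sum.
apply: eq_bigr => i _; rewrite poly_atZ poly_atX mxE mulrC; congr (_ * \det _ * _).
by apply/matrixP => k l; rewrite !mxE.
Qed.

Lemma msupp_VDM_poly n (j : 'I_n.+1) zeta m :
  m \in msupp (VDM_poly j zeta) -> exists i : 'I_n.+1, m = alpha i.
Proof.
move=> /msupp_sum_le/flattenP[s /mapP[i _ ->]] /msuppZ_le.
by rewrite msuppX inE => /eqP ->; exists i.
Qed.

Lemma mcoeff_VDM_poly n (j : 'I_n.+1) zeta :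
  mcoeff (alpha n) (VDM_poly j zeta) = (-1) ^+ (n + j) * VDM alpha zeta.
Proof.
rewrite /VDM_poly raddf_sum /= (bigD1 ord_max)//= mcoeffZ mcoeffX eqxx mulr1.
rewrite big1 ?addr0 => [|i /eqP ni].
  congr (_ * \det _); apply/matrixP => i k; rewrite !mxE /=.
  by rewrite /bump leqNgt ltn_ord add0n.
rewrite mcoeffZ mcoeffX (inj_eq listing_inj) -[n]/(nat_of_ord (@ord_max n)).
by case: eqP => [/val_inj//|]; rewrite mulr0.
Qed.

End Vandermonde.

(** * Maximal Vandermonde moduli and products of Chebyshev constants *)

Section MaxVandermonde.
Variables (R : realType) (N : nat) (alpha : nat -> multinom N).
Hypothesis halpha : deglex_listing alpha.
Variable E : set (Cspace R N).
Hypothesis cE : compact E.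
Implicit Types (Q : mpoly N R[i]) (z : Cspace R N).

Local Notation V := (max_VDM alpha E).

(** This makes the supremum in [max_VDM] an upper bound. Induction by expansion along the last row
    takes the place of compactness of the power of [E]. *)
Lemma VDM_bounded n : exists c, forall zeta : 'I_n -> Cspace R N,
  (forall j, E (zeta j)) -> cmod (VDM alpha zeta) <= c.
Proof.
elim: n => [|n [c IHn]].
  by exists 1 => zeta _; rewrite /VDM det_mx00 cmod1.
exists (\sum_(j < n.+1) sup_norm E (poly_at (mpolyX _ (alpha n))) * c) => zeta Ez.
rewrite (VDM_row_expansion halpha zeta (monic_of_lead_mpolyX _ _)).
apply: le_trans (cmod_sum _ _) _; apply: ler_sum => j _.
rewrite !cmodM cmod_sign mul1r ler_pM ?cmod_ge0 ?le_sup_norm//.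
by apply: IHn => k; exact: Ez.
Qed.

Lemma le_max_VDM n (zeta : 'I_n -> Cspace R N) :
  (forall j, E (zeta j)) -> cmod (VDM alpha zeta) <= V n.
Proof.
move=> Ez; apply: ub_le_sup; last by exists zeta.
by have [c cV] := VDM_bounded n; exists c => _ [zeta' Ez' <-]; exact: cV.
Qed.

Lemma max_VDM_le n c : 0 <= c -> (forall zeta : 'I_n -> Cspace R N,
  (forall j, E (zeta j)) -> cmod (VDM alpha zeta) <= c) -> V n <= c.
Proof.
move=> c0 cV; rewrite /max_VDM; set S := [set _ | _ in _].
have [->|/set0P S0] := eqVneq S set0; first by rewrite sup0.
by apply: ge_sup => // _ [zeta Ez <-]; exact: cV.
Qed.

Lemma max_VDM_ge0 n : 0 <= V n.
Proof.
rewrite /max_VDM; set S := [set _ | _ in _].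
have [->|/set0P[_ [zeta Ez _]]] := eqVneq S set0; first by rewrite sup0.
exact: le_trans (cmod_ge0 _) (le_max_VDM Ez).
Qed.

Lemma max_VDM0 : V 0 = 1.
Proof.
apply/le_anti/andP; split.
  by apply: max_VDM_le => // zeta _; rewrite /VDM det_mx00 cmod1.
rewrite -(@cmod1 R) -(@det_mx00 R[i] (\matrix_(i < 0, j < 0) 0)).
have zeta : 'I_0 -> Cspace R N by case.
rewrite (_ : \det _ = VDM alpha zeta); last by rewrite /VDM !det_mx00.
by apply: le_max_VDM; case.
Qed.

(** With a competitor [Q] in the last row, each of the [n.+1] terms of the expansion is at most the
    norm of [Q] times [V n]. *)
Lemma max_VDM_succ_le n : V n.+1 <= n.+1%:R * V n * cheb E (alpha n).
Proof.
apply: cheb_glbM => [|Q nQ]; first by rewrite mulr_ge0// max_VDM_ge0.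
apply: max_VDM_le => [|zeta Ez].
  by rewrite !mulr_ge0 ?max_VDM_ge0 ?sup_norm_ge0.
rewrite (VDM_row_expansion halpha zeta nQ).
apply: le_trans (cmod_sum _ _) _.
apply: (@le_trans _ _ (\sum_(j < n.+1) sup_norm E (poly_at Q) * V n)).
  apply: ler_sum => j _; rewrite !cmodM cmod_sign mul1r.
  rewrite ler_pM ?cmod_ge0 ?le_sup_norm//.
  by apply: le_max_VDM => k; exact: Ez.
by rewrite sumr_const card_ord -[_ *+ _]mulr_natl mulrAC mulrA.
Qed.

(** Fix [n] points with nonzero determinant and add a variable one. The determinant is then a
    polynomial in the new point with leading coefficient, up to sign, the old determinant; dividing
    by it gives a competitor for [cheb E (alpha n)]. *)
Lemma le_max_VDM_succ n : V n * cheb E (alpha n) <= V n.+1.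
Proof.
have [T0|T0] := eqVneq (cheb E (alpha n)) 0; first by rewrite T0 mulr0 max_VDM_ge0.
have Tgt0 : 0 < cheb E (alpha n) by rewrite lt_neqAle eq_sym T0 cheb_ge0.
rewrite -ler_pdivlMr//; apply: max_VDM_le => [|zeta Ez].
  by rewrite divr_ge0 ?max_VDM_ge0 ?cheb_ge0.
rewrite ler_pdivlMr//.
have [->|VDM0] := eqVneq (VDM alpha zeta) 0; first by rewrite cmod0 mul0r max_VDM_ge0.
pose P := VDM_poly alpha ord_max zeta.
have nP := mcoeff_VDM_poly halpha ord_max zeta.
have P0 : mcoeff (alpha n) P != 0 by rewrite nP mulf_neq0// signr_eq0.
have cP : cmod (mcoeff (alpha n) P) = cmod (VDM alpha zeta).
  by rewrite nP cmodM cmod_sign mul1r.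
have V_gt0 : 0 < cmod (VDM alpha zeta) by rewrite lt_neqAle eq_sym cmod_eq0 VDM0 cmod_ge0.
have monicP : monic_of_lead (alpha n) ((mcoeff (alpha n) P)^-1 *: P).
  split=> [|m /msuppZ_le /msupp_VDM_poly[i ->]]; first by rewrite mcoeffZ mulVf.
  by rewrite listing_le// -ltnS ltn_ord.
rewrite mulrC -ler_pdivlMr//; apply: le_trans (cheb_le E monicP) _.
apply: sup_norm_le => [|z Ez']; first by rewrite divr_ge0 ?max_VDM_ge0 ?cmod_ge0.
pose zeta' j := if unlift ord_max j is Some k then zeta k else z.
have zetaE : zeta' \o lift ord_max = zeta by apply/funext => k; rewrite /zeta' /= liftK.
have Pz : poly_at P z = VDM alpha zeta'.
  by rewrite (VDM_polyE alpha ord_max zeta') zetaE /zeta' unlift_none.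
rewrite ler_pdivlMr// poly_atZ mulrC cmodM -cP mulrA -cmodM mulfV// cmod1 mul1r Pz.
by apply: le_max_VDM => j; rewrite /zeta'; case: unliftP.
Qed.

Lemma max_VDM_prod_cheb n :
  \prod_(i < n) cheb E (alpha i) <= V n <= n`!%:R * \prod_(i < n) cheb E (alpha i).
Proof.
elim: n => [|n /andP[IHl IHr]]; first by rewrite !big_ord0 max_VDM0 mul1r lexx.
rewrite !big_ord_recr /=; apply/andP; split.
  by apply: le_trans (le_max_VDM_succ n); rewrite ler_wpM2r// cheb_ge0.
apply: le_trans (max_VDM_succ_le n) _.
by rewrite mulrA ler_wpM2r ?cheb_ge0// factS natrM -mulrA ler_wpM2l.
Qed.

(** Forgets the exponent of the slack variable, which is variable [ord0]. *)
Definition tail_mnm (c : multinom N.+1) : multinom N :=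
  Multinom [tuple c (lift ord0 i) | i < N].

Lemma tail_mnmE c i : tail_mnm c i = c (lift ord0 i).
Proof. exact: mnmE. Qed.

Lemma mdeg_tail_mnm c : mdeg c = (c ord0 + mdeg (tail_mnm c))%N.
Proof.
rewrite !mdegE big_ord_recl; congr addn.
by apply: eq_bigr => i _; rewrite tail_mnmE.
Qed.

Lemma tail_mnmD a b : tail_mnm (mnm_add a b) = mnm_add (tail_mnm a) (tail_mnm b).
Proof. by apply/mnmP => i; rewrite !(mnmDE, tail_mnmE). Qed.

Lemma tail_mnms_uniq d : uniq (map tail_mnm (mnms_of_deg N.+1 d)).
Proof.
rewrite map_inj_in_uniq ?mnms_of_deg_uniq// => a b.
rewrite !mem_mnms_of_deg => /eqP da /eqP db ab.
apply/mnmP => i; case: (unliftP ord0 i) => [k ->|->].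
  by rewrite -!tail_mnmE ab.
by apply/eqP; rewrite -(eqn_add2r (mdeg (tail_mnm a))) -mdeg_tail_mnm ab -mdeg_tail_mnm da db.
Qed.

Lemma mem_tail_mnms d a : (a \in map tail_mnm (mnms_of_deg N.+1 d)) = (mdeg a <= d)%N.
Proof.
apply/mapP/idP => [[c]|ad].
  by rewrite mem_mnms_of_deg => /eqP <- ->; rewrite mdeg_tail_mnm leq_addl.
pose c := Multinom [tuple if unlift ord0 i is Some k then a k else (d - mdeg a)%N | i < N.+1].
have ca : tail_mnm c = a by apply/mnmP => i; rewrite tail_mnmE mnmE liftK.
exists c => //; rewrite mem_mnms_of_deg mdeg_tail_mnm ca mnmE unlift_none.
by rewrite subnK.
Qed.

(** Both lists are duplicate-free of the same length, so one inclusion suffices. *)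
Lemma perm_listing d :
  perm_eq (map alpha (iota 0 (num_monomials N d))) (map tail_mnm (mnms_of_deg N.+1 d)).
Proof.
set L := map tail_mnm _.
have uL : uniq L by exact: tail_mnms_uniq.
have sizeL : size L = num_monomials N d by rewrite size_map size_mnms_of_deg.
have inc := listing_inj halpha.
have u_alpha : uniq (map alpha (iota 0 (num_monomials N d))).
  by rewrite map_inj_uniq// iota_uniq.
apply: uniq_perm => //.
have sub : {subset map alpha (iota 0 (num_monomials N d)) <= L}.
  move=> b hb; have [i + ->] := mapP hb.
  rewrite mem_iota add0n /= -sizeL => iL.
  (* If [alpha i] had degree above [d], all the multi-indices of degree at most [d] would be listed
     before it, and [i] places are too few for them. *)
  rewrite mem_tail_mnms leqNgt; apply/negP => di; move: iL; apply/negP; rewrite -leqNgt.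
  rewrite -[leqRHS](size_iota 0) -(size_map alpha); apply: uniq_leq_size => // a.
  rewrite mem_tail_mnms => ad; have [j ja] := halpha.1 a.
  apply/mapP; exists j => //; rewrite mem_iota /= add0n -(listing_lt halpha) ja.
  exact/lt_mdeg_ltmc/(leq_ltn_trans ad).
by have [] := uniq_min_size u_alpha sub; rewrite // sizeL size_map size_iota.
Qed.

Lemma mdeg_listing d i : (mdeg (alpha i) <= d)%N = (i < num_monomials N d)%N.
Proof.
rewrite -mem_tail_mnms -(perm_mem (perm_listing d)) mem_map; last exact: listing_inj.
by rewrite mem_iota.
Qed.

Lemma prod_listing (S : comPzSemiRingType) (G : multinom N -> S) d :
  \prod_(i < num_monomials N d) G (alpha i) =
  \prod_(c <- mnms_of_deg N.+1 d) G (tail_mnm c).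
Proof.
rewrite -(big_mkord xpredT (fun i => G (alpha i))) -(big_map alpha xpredT G).
by rewrite /index_iota subn0 (perm_big _ (perm_listing d)) big_map.
Qed.

End MaxVandermonde.

(** * Existence of the transfinite diameter *)

Section DegreeCounts.
Variables (R : realType) (N : nat).
Hypothesis N_gt0 : (0 < N)%N.

Lemma sum_degreesE d : (sum_degrees N d * N.+1 = N * d * num_monomials N d)%N.
Proof.
rewrite /sum_degrees /num_monomials -mulnA [(_ * N.+1)%N]mulnC mul_bin_left addKn mulnA.
by rewrite -(bin_sub (leq_addr d N)) addKn.
Qed.

Lemma num_monomials_gt0 d : (0 < num_monomials N d)%N.
Proof. by rewrite bin_gt0 leq_addl. Qed.

Lemma sum_degrees_gt0 d : (0 < d)%N -> (0 < sum_degrees N d)%N.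
Proof.
move=> d0; rewrite -(ltn_pmul2r (ltn0Sn N)) mul0n sum_degreesE.
by rewrite !muln_gt0 N_gt0 d0 num_monomials_gt0.
Qed.

(** Since this ratio is of order [1 / d], a factor c^(m_d) tends to 1 under the root of order
    l_d. *)
Lemma num_monomials_div_sum_degrees d : (0 < d)%N ->
  (num_monomials N d)%:R / (sum_degrees N d)%:R = N.+1%:R / N%:R / d%:R :> R.
Proof.
move=> d0; have := congr1 (fun n => n%:R : R) (sum_degreesE d).
rewrite [LHS]natrM ![in RHS]natrM => e.
have l0 : (sum_degrees N d)%:R != 0 :> R by rewrite pnatr_eq0 -lt0n sum_degrees_gt0.
have N0 : N%:R != 0 :> R by rewrite pnatr_eq0 -lt0n.
have d0' : d%:R != 0 :> R by rewrite pnatr_eq0 -lt0n.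
apply/eqP; rewrite -[N.+1%:R / _ / _]mulrA -invfM eqr_div ?mulf_neq0//.
by rewrite mulrC -e mulrC.
Qed.

Lemma bin_le_expn n m : ('C(n, m) <= n ^ m)%N.
Proof.
elim: n m => [|n IHn] [|m]; rewrite ?bin0 ?expn0 ?bin0n//.
rewrite binS (leq_trans (leq_add (IHn _) (IHn _)))// !expnS -mulSnr.
by rewrite leq_mul2l /=; case: m => // m; rewrite leq_exp2r.
Qed.

Lemma fact_le_expn n : (n`! <= n ^ n)%N.
Proof.
elim: n => // n IHn; rewrite factS expnS leq_mul2l /=.
apply: leq_trans IHn _; case: n => // n.
by rewrite leq_exp2r.
Qed.

(** From m! <= m^m and m_d <= (N + d)^N. After division by l_d the bound is of order ln(N + d) /
    d. *)
Lemma ln_fact_num_monomials_le d :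
  ln ((num_monomials N d)`!%:R) <=
  (num_monomials N d)%:R * (N%:R * ln (N + d)%:R) :> R.
Proof.
set m := num_monomials N d.
have m0 : (0 < m)%N := num_monomials_gt0 d.
have Nd0 : (0 < N + d)%N by rewrite addn_gt0 N_gt0.
have -> : m%:R * (N%:R * ln (N + d)%:R) = ln (((N + d) ^ N) ^ m)%:R :> R.
  by rewrite !natrX !lnXn ?exprn_gt0 ?ltr0n// !mulr_natl.
rewrite ler_ln ?posrE ?ltr0n ?fact_gt0 ?expn_gt0 ?Nd0// ler_nat.
apply: leq_trans (fact_le_expn m) _; rewrite leq_exp2r//.
by rewrite /m /num_monomials -(bin_sub (leq_addl N d)) addnK bin_le_expn.
Qed.

Lemma cvg_ln_div : ln (N + d)%:R / d%:R @[d --> \oo] --> (0 : R).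
Proof.
apply/cvgrPdist_le => e e0; near=> d.
have d0 : (0 < d)%N by near: d; exists 1%N.
have Nd : (N <= d)%N by near: d; exists N.
(* This threshold gives 2 d <= (e d)^2 / 2, hence N + d <= 2 d <= exp(e d). *)
have d4 : 4 / e ^+ 2 <= d%:R by near: d; exact: nbhs_infty_ger.
have dR0 : 0 < d%:R :> R by rewrite ltr0n.
rewrite sub0r normrN ger0_norm; last first.
  by rewrite divr_ge0// ln_ge0// ler1n addn_gt0 N_gt0.
rewrite ler_pdivrMr// -[leRHS]expRK ler_ln ?posrE ?expR_gt0 ?ltr0n ?addn_gt0 ?N_gt0//.
apply: le_trans (_ : 1 + (e * d%:R) ^+ 2 / 2`!%:R <= _); last first.
  by apply: expR_ge1Dxn; rewrite mulr_ge0// ltW.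
apply: (@le_trans _ _ (2 * d%:R)).
  by rewrite natrD mulr_natl mulr2n lerD2r ler_nat.
rewrite -[leLHS]add0r lerD//.
move: d4; rewrite ler_pdivrMr ?exprn_gt0// => d4.
rewrite exprMn (_ : 2`! = 2)//; nra.
Unshelve. all: by end_near. Qed.

End DegreeCounts.

Section Zaharjuta.
Variables (R : realType) (N : nat).
Hypothesis N_gt0 : (0 < N)%N.
Variable alpha : nat -> multinom N.
Hypothesis halpha : deglex_listing alpha.
Variable E : set (Cspace R N).
Hypothesis cE : compact E.

Let W d := max_VDM alpha E (num_monomials N d) `^ (sum_degrees N d)%:R^-1.

(** Once [d] reaches the degree of [a], the vanishing factor occurs in the product bounding
    [max_VDM], so the sequence is eventually 0. *)
Lemma cvg_max_VDM_degenerate a : cheb E a = 0 -> W @ \oo --> 0.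
Proof.
move=> Ta; apply: cvg_near_cst; near=> d.
have d0 : (0 < d)%N by near: d; exists 1%N.
have ad : (mdeg a <= d)%N by near: d; exists (mdeg a).
have /andP[_] := max_VDM_prod_cheb halpha cE (num_monomials N d).
have [i ia] := halpha.1 a; have im : (i < num_monomials N d)%N.
  by rewrite -(mdeg_listing halpha) ia.
rewrite (bigD1 (Ordinal im))//= ia Ta mul0r mulr0 => V_le0.
rewrite /W (@le_anti _ _ (max_VDM alpha E (num_monomials N d)) 0); last first.
  by rewrite V_le0 max_VDM_ge0.
by rewrite powR0// invr_eq0 pnatr_eq0 -lt0n sum_degrees_gt0.
Unshelve. all: by end_near. Qed.

(** Squeeze: the root of order l_d of the product of Chebyshev constants is the exponential of
    [k * mnms_mean f d / d], which converges by Fekete's lemma, and the root of the factorial tends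
    to 1. *)
Lemma cvg_max_VDM_positive : (forall a, 0 < cheb E a) -> exists L : R, W @ \oo --> L.
Proof.
move=> T_gt0; pose f (c : multinom N.+1) := ln (cheb E (tail_mnm c)).
have fD a b : f (mnm_add a b) <= f a + f b.
  by rewrite /f tail_mnmD -lnM ?posrE ?T_gt0// ler_ln ?posrE ?mulr_gt0 ?T_gt0// chebD.
pose k : R := N.+1%:R / N%:R.
have k_ge0 : 0 <= k by rewrite divr_ge0.
have [|L cvgL] := @fekete_expR R (fun d => k * mnms_mean f d).
  by move=> i j; rewrite -mulrDr ler_wpM2l// mnms_mean_subadditive.
exists L.
have cvgU : expR (k * mnms_mean f d / d%:R) * expR (k * (N%:R * (ln (N + d)%:R / d%:R)))
    @[d --> \oo] --> L.
  rewrite -[X in _ --> X]mulr1; apply: cvgM cvgL _; rewrite -[X in _ --> X]expR0.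
  apply: continuous_cvg; first exact: continuous_expR.
  rewrite -[X in _ --> X](mulr0 k); apply: cvgMr; rewrite -[X in _ --> X](mulr0 N%:R).
  by apply: cvgMr; exact: cvg_ln_div.
apply: squeeze_cvgr cvgL cvgU; near=> d.
have d0 : (0 < d)%N by near: d; exists 1%N.
set S := \sum_(c <- mnms_of_deg N.+1 d) f c.
set m := num_monomials N d; set l := (sum_degrees N d)%:R^-1 : R.
have prodE : \prod_(i < m) cheb E (alpha i) = expR S.
  rewrite (prod_listing halpha (cheb E)) expR_sum; apply: eq_bigr => c _.
  by rewrite lnK ?posrE ?T_gt0.
have m_neq0 : m%:R != 0 :> R by rewrite pnatr_eq0 -lt0n num_monomials_gt0.
have ml : m%:R * l = k / d%:R by rewrite num_monomials_div_sum_degrees.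
have -> : k * mnms_mean f d / d%:R = S * l.
  by rewrite mulrAC -ml /mnms_mean -/S mulrC mulrA divfK.
have l_ge0 : 0 <= l by rewrite invr_ge0.
have /andP[Vl Vu] := max_VDM_prod_cheb halpha cE m.
rewrite prodE in Vl Vu; apply/andP; split.
  by rewrite expRM ge0_ler_powR ?nnegrE ?expR_ge0 ?max_VDM_ge0.
apply: (@le_trans _ _ ((m`!%:R * expR S) `^ l)).
  by rewrite ge0_ler_powR ?nnegrE ?mulr_ge0 ?expR_ge0 ?max_VDM_ge0.
rewrite powRM ?expR_ge0// -expRM mulrC ler_wpM2l ?expR_ge0//.
rewrite -[m`!%:R]lnK ?posrE ?ltr0n ?fact_gt0// -expRM ler_expR.
rewrite [leRHS](_ : _ = m%:R * (N%:R * ln (N + d)%:R) * l); last first.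
  by rewrite [RHS]mulrAC ml -!mulrA [d%:R^-1 * _]mulrC !mulrA.
by rewrite ler_wpM2r// ln_fact_num_monomials_le.
Unshelve. all: by end_near. Qed.

Lemma cvg_transfinite_diameter : W @ \oo --> transfinite_diameter alpha E.
Proof.
suff [L cvgL] : exists L : R, W @ \oo --> L.
  by rewrite /transfinite_diameter (cvg_lim _ cvgL).
have [[a Ta]|T_neq0] := pselect (exists a, cheb E a = 0).
  by exists 0; exact: cvg_max_VDM_degenerate Ta.
apply: cvg_max_VDM_positive => a; rewrite lt_neqAle cheb_ge0 andbT eq_sym.
by apply/eqP => Ta; apply: T_neq0; exists a.
Qed.

End Zaharjuta.

(** * Iterated integrals and the Bernstein-Markov inequality *)

Definition update (T : Type) n (j : 'I_n) (x : T) (zeta : 'I_n -> T) : 'I_n -> T :=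
  fun i => if i == j then x else zeta i.

Section IteratedIntegral.
Context (d : measure_display) (T : measurableType d) (R : realType).
Variables (mu : {measure set T -> \bar R}) (A : set T).

(* No measurability is needed, integrals of nonnegative functions being suprema
   over simple functions below them; this spares a proof that inner iterated
   integrals are measurable in the outer variables. *)
Lemma le_integral_ge0 (f g : T -> \bar R) :
  (forall x, A x -> 0 <= f x)%E -> (forall x, A x -> f x <= g x)%E ->
  (\int[mu]_(x in A) f x <= \int[mu]_(x in A) g x)%E.
Proof.
move=> f0 fg; rewrite !ge0_integralE//; last first.
  by move=> x Ax; exact: le_trans (f0 _ Ax) (fg _ Ax).
apply: ereal_sup_le => _ [h /= hf <-]; exists h => //= x.
by apply: le_trans (hf x) _; exact: lee_restrict.
Qed.

Lemma iterated_integral_ge0 n (f : n.-tuple T -> \bar R) :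
  (forall t, (forall i, A (tnth t i)) -> 0 <= f t)%E ->
  (0 <= iterated_integral mu A f)%E.
Proof.
elim: n f => [|n IHn] f f0 /=; first by apply: f0; case.
apply: integral_ge0 => x Ax; apply: IHn => t At; apply: f0 => i.
by case: (unliftP ord0 i) => [j ->|->]; rewrite ?tnthS// tnth0.
Qed.

Lemma iterated_integral_le n (f : n.-tuple T -> \bar R) (c m : R) :
  measurable A -> mu A = m%:E ->
  (forall t, (forall i, A (tnth t i)) -> 0 <= f t <= c%:E)%E ->
  (iterated_integral mu A f <= (c * m ^+ n)%:E)%E.
Proof.
move=> mA mu_m; elim: n f => [|n IHn] f f0 /=.
  by rewrite mulr1; have /andP[] := f0 [tuple] (fun i => False_ind _ (notF (ltn_ord i))).
have Acons x t : A x -> (forall i, A (tnth t i)) ->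
    forall i : 'I_n.+1, A (tnth [tuple of x :: t] i).
  by move=> Ax At i; case: (unliftP ord0 i) => [j ->|->]; rewrite ?tnthS// tnth0.
apply: (@le_trans _ _ (\int[mu]_(x in A) cst (c * m ^+ n)%:E x)%E).
  apply: le_integral_ge0 => x Ax; last by apply: IHn => t At; exact/f0/Acons.
  apply: iterated_integral_ge0 => t At.
  by have /andP[] := f0 [tuple of x :: t] (Acons _ _ Ax At).
by rewrite integral_cst// mu_m -EFinM exprSr mulrA.
Qed.

(** The squared Bernstein-Markov inequality in a single point, in the form in which it is
    iterated. *)
Definition point_bound (K : R) (G : T -> R) : Prop :=
  [/\ measurable_fun setT G, forall x, 0 <= G x &
      forall x, A x -> ((G x)%:E <= K%:E * \int[mu]_(y in A) (G y)%:E)%E].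

(** The points are integrated out one by one: the bound in the first point costs a factor [K], and
    the induction hypothesis handles the others with the first one frozen at [x]. *)
Lemma le_iterated_integral n (H : ('I_n -> T) -> R) (K : R) (zeta : 'I_n -> T) :
  measurable A -> 0 < K ->
  (forall xi, 0 <= H xi) ->
  (forall j xi, point_bound K (fun x => H (update j x xi))) ->
  (forall i, A (zeta i)) ->
  ((H zeta)%:E <= (K ^+ n)%:E * iterated_integral mu A (fun t => (H (tnth t))%:E))%E.
Proof.
move=> mA K0; elim: n H zeta => [|n IHn] H zeta H0 HK Azeta /=.
  rewrite expr0 mul1e (_ : zeta = tnth [tuple])//.
  by apply/funext; case.
pose ext x (xi : 'I_n -> T) := fun i => if unlift ord0 i is Some k then xi k else x.
pose xi := zeta \o lift ord0.
have ext_zeta x : ext x xi = update ord0 x zeta.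
  apply/funext => i; rewrite /ext /update.
  by case: (unliftP ord0 i) => [k ->|->]; rewrite ?eqxx// eq_sym (negbTE (neq_lift _ _)).
have [mG G0 GK] := HK ord0 zeta.
have HG : H zeta = H (update ord0 (zeta ord0) zeta).
  by congr H; apply/funext => i; rewrite /update; case: eqP => [->|].
have ext_tnth x (t : n.-tuple T) : tnth [tuple of x :: t] = ext x (tnth t).
  apply/funext => i; rewrite /ext.
  by case: (unliftP ord0 i) => [k ->|->]; rewrite ?tnthS// tnth0.
rewrite HG; apply: le_trans (GK _ (Azeta ord0)) _.
rewrite exprS EFinM -muleA lee_pmul2l ?lte_fin//.
(* The constant is moved as [K ^- n] into the integral of the measurable function on the left, so
   that nothing has to be pulled out of the integral of the inner iterated integrals. *)
rewrite -[leLHS]mul1e -(mulfV (lt0r_neq0 (exprn_gt0 n K0))) EFinM -muleA.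
rewrite lee_pmul2l ?lte_fin ?exprn_gt0//.
rewrite -ge0_integralZl_EFin//; last 3 first.
- by move=> x _; rewrite lee_fin.
- by apply/measurable_EFinP; exact: measurable_funS mG.
- by rewrite invr_ge0 exprn_ge0// ltW.
apply: le_integral_ge0 => x Ax.
  by rewrite -EFinM lee_fin mulr_ge0// invr_ge0 exprn_ge0// ltW.
rewrite muleC lee_pdivrMr ?exprn_gt0//.
under eq_fun do rewrite ext_tnth.
rewrite -ext_zeta muleC; apply: (IHn (fun t => H (ext x t))) => // [j t|j]; last exact: Azeta.
suff -> : (fun y => H (ext x (update j y t))) = (fun y => H (update (lift ord0 j) y (ext x t))).
  exact: HK.
apply/funext => y; congr H; apply/funext => i; rewrite /ext /update.
by case: (unliftP ord0 i) => [k ->|->]; rewrite ?(inj_eq lift_inj)//.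
Qed.

End IteratedIntegral.

Section BorelMeasurability.
Variables (R : realType) (N : nat).

Lemma open_measurable_Cspace (U : set (Cspace R N)) :
  open U -> measurable (U : set (borelCspace R N)).
Proof. by move=> oU; exact: sub_sigma_algebra. Qed.

Lemma compact_measurable_Cspace (E : set (Cspace R N)) :
  compact E -> measurable (E : set (borelCspace R N)).
Proof.
move=> cE; rewrite -(setCK (E : set (borelCspace R N))); apply: measurableC.
apply: open_measurable_Cspace; apply: closed_openC.
exact: compact_closed (@Cspace_hausdorff R N) cE.
Qed.

Lemma measurable_cmod_poly_at (Q : mpoly N R[i]) :
  measurable_fun setT (fun z : borelCspace R N => cmod (poly_at Q z)).
Proof.
apply: (measurability _ (RGenOpens.measurableE R)) => _ [_ [a [b ->] <-]].
rewrite setTI; apply: open_measurable_Cspace.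
by apply: open_comp; [move=> z _; exact: continuous_cmod_poly_at|exact: interval_open].
Qed.

Variable E : set (Cspace R N).
Hypothesis cE : compact E.
Variable mu : {measure set (borelCspace R N) -> \bar R}.
Hypothesis muE : mu (~` E) = 0%E.

Lemma point_bound_cmod_poly_at (Q : mpoly N R[i]) (C : R) : 0 <= C ->
  ((sup_norm E (poly_at Q))%:E <=
     C%:E * 'N[mu]_2%:E[EFin \o (fun z => cmod (poly_at Q z))])%E ->
  point_bound mu E (C ^+ 2) (fun z => cmod (poly_at Q z) ^+ 2).
Proof.
move=> C0 QC; have mQ := measurable_cmod_poly_at Q.
have mQ2 := measurable_funX 2 mQ.
have mE := compact_measurable_Cspace cE.
split => [//|z|z Ez]; first by rewrite sqr_ge0.
(* As [mu] vanishes off [E], the squared norm over the whole space is an integral over [E]. *)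
have -> : (\int[mu]_(y in E) (cmod (poly_at Q y) ^+ 2)%:E)%E =
    ('N[mu]_2%:E[EFin \o (fun z => cmod (poly_at Q z))] `^ 2)%E.
  rewrite poweR_Lnorm//; transitivity (\int[mu]_y (cmod (poly_at Q y) ^+ 2)%:E)%E; last first.
    apply: eq_integral => y _.
    by rewrite /= powR_mulrn ?normr_ge0// ger0_norm ?cmod_ge0.
  rewrite [RHS](@ge0_negligible_integral _ (borelCspace R N) _ _ _ (~` E))//.
  - by rewrite setTD setCK.
  - exact: measurableC.
  - exact/measurable_EFinP.
  - by move=> y _; rewrite lee_fin sqr_ge0.
rewrite -(powR_mulrn _ (cmod_ge0 _)) -(powR_mulrn _ C0) -!poweR_EFin -poweRM ?Lnorm_ge0//.
apply: gt0_ler_poweR => //; rewrite ?in_itv /= ?leey ?andbT ?lee_fin ?cmod_ge0 ?mule_ge0 ?Lnorm_ge0//.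
by apply: le_trans QC; rewrite lee_fin le_sup_norm.
Qed.

End BorelMeasurability.

(** * Upper and lower bounds for Z_d and its limit *)

Section PartitionFunction.
Variables (R : realType) (N : nat).
Hypothesis N_gt0 : (0 < N)%N.
Variable alpha : nat -> multinom N.
Hypothesis halpha : deglex_listing alpha.
Variable E : set (Cspace R N).
Hypothesis cE : compact E.
Variable mu : {finite_measure set (borelCspace R N) -> \bar R}.
Hypothesis muE : mu (~` E) = 0%E.

(** In each single point the determinant is a polynomial of degree at most [D], so the
    Bernstein-Markov inequality applies to it. *)
Lemma cmod_VDM_update n (j : 'I_n) (xi : 'I_n -> Cspace R N) D :
  (forall i, (i < n)%N -> (mdeg (alpha i) <= D)%N) ->
  exists2 Q : mpoly N R[i], (msize Q <= D.+1)%N &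
    forall x, VDM alpha (update j x xi) = poly_at Q x.
Proof.
case: n j xi => [[]//|n] j xi degD.
exists (VDM_poly alpha j (xi \o lift j)) => [|x].
  rewrite msizeE; apply/bigmax_leqP_seq => m mQ _; rewrite ltnS.
  by have [i ->] := msupp_VDM_poly mQ; exact: degD.
have e : update j x xi \o lift j = xi \o lift j.
  by apply/funext => k /=; rewrite /update eq_sym (negbTE (neq_lift _ _)).
by rewrite (VDM_polyE alpha j) e /update eqxx.
Qed.

Lemma Z_ge0 d : (0 <= Z_ alpha E mu d)%E.
Proof. by apply: iterated_integral_ge0 => t _; rewrite lee_fin sqr_ge0. Qed.

Lemma Z_le d : (Z_ alpha E mu d <=
  (max_VDM alpha E (num_monomials N d) ^+ 2 * fine (mu E) ^+ num_monomials N d)%:E)%E.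
Proof.
have mE := compact_measurable_Cspace cE.
apply: iterated_integral_le => //; first by rewrite fineK// fin_num_measure.
move=> t Et; rewrite !lee_fin sqr_ge0 /= ler_sqr ?nnegrE ?cmod_ge0 ?max_VDM_ge0//.
exact: le_max_VDM.
Qed.

Lemma Z_fin_num d : Z_ alpha E mu d \is a fin_num.
Proof. by rewrite ge0_fin_numE ?Z_ge0// (le_lt_trans (Z_le d)) ?ltry. Qed.

Lemma sqr_max_VDM_le_Z d (C : R) : 0 < C ->
  (forall Q : mpoly N R[i], (msize Q <= d.+1)%N ->
    ((sup_norm E (poly_at Q))%:E <=
     C%:E * 'N[mu]_2%:E[EFin \o (fun z => cmod (poly_at Q z))])%E) ->
  max_VDM alpha E (num_monomials N d) ^+ 2 <=
  (C ^+ 2) ^+ num_monomials N d * fine (Z_ alpha E mu d).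
Proof.
move=> C0 BM; set m := num_monomials N d.
have rhs_ge0 : 0 <= (C ^+ 2) ^+ m * fine (Z_ alpha E mu d).
  by rewrite mulr_ge0 ?fine_ge0 ?Z_ge0// !exprn_ge0// ltW.
(* The right side is written as a square to reduce to a bound on [max_VDM] itself, hence on each
   determinant. *)
rewrite -[leRHS]sqr_sqrtr// ler_sqr ?nnegrE ?max_VDM_ge0 ?sqrtr_ge0//.
apply: max_VDM_le => [|zeta Ezeta]; first exact: sqrtr_ge0.
rewrite -[leLHS]ger0_norm ?cmod_ge0// -sqrtr_sqr ler_sqrt//.
rewrite -lee_fin [leRHS]EFinM fineK ?Z_fin_num//.
apply: (@le_iterated_integral _ _ _ mu E _ (fun xi => cmod (VDM alpha xi) ^+ 2)) => //.
- exact: compact_measurable_Cspace.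
- by rewrite exprn_gt0.
- by move=> xi; rewrite sqr_ge0.
move=> j xi; have [|Q degQ QE] := @cmod_VDM_update m j xi d.
  by move=> i; rewrite mdeg_listing.
under eq_fun do rewrite QE.
by apply: point_bound_cmod_poly_at => //; [exact: ltW|exact: BM].
Qed.

Local Notation W d :=
  (max_VDM alpha E (num_monomials N d) `^ (sum_degrees N d)%:R^-1).
Local Notation zr d :=
  (fine (Z_ alpha E mu d) `^ (2 * sum_degrees N d)%:R^-1).
Local Notation k := (N.+1%:R / N%:R : R).

Lemma sqr_powR_root d : W d =
  (max_VDM alpha E (num_monomials N d) ^+ 2) `^ (2 * sum_degrees N d)%:R^-1.
Proof.
by rewrite -powR_mulrn ?max_VDM_ge0// -powRrM natrM invfM mulrA mulfV ?mul1r.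
Qed.

Lemma expr_num_monomials_root (c : R) d : (0 < d)%N ->
  0 < c -> (c ^+ num_monomials N d) `^ (2 * sum_degrees N d)%:R^-1 =
  expR (ln c * (k / d%:R / 2)).
Proof.
move=> d0 c0; rewrite -[in LHS](lnK c0) -expRM_natr -expRM -mulrA.
by rewrite natrM invfM [2^-1 * _]mulrC (mulrA (num_monomials N d)%:R) num_monomials_div_sum_degrees.
Qed.

Lemma Z_root_le d : (0 < d)%N ->
  zr d <= W d * expR (ln (Num.max 1 (fine (mu E))) * (k / d%:R / 2)).
Proof.
(* The measure of [E] may be 0; the maximum with 1 keeps the logarithm meaningful. *)
move=> d0; have c_gt0 : 0 < Num.max 1 (fine (mu E)) by rewrite lt_max ltr01.
rewrite -expr_num_monomials_root// sqr_powR_root -powRM ?sqr_ge0 ?exprn_ge0 ?(ltW c_gt0)//.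
rewrite ge0_ler_powR ?nnegrE ?invr_ge0 ?fine_ge0 ?Z_ge0//.
  by rewrite mulr_ge0 ?sqr_ge0 ?exprn_ge0 ?(ltW c_gt0).
rewrite -lee_fin fineK ?Z_fin_num//; apply: le_trans (Z_le d) _.
rewrite lee_fin ler_wpM2l ?sqr_ge0// lerXn2r ?nnegrE ?fine_ge0 ?(ltW c_gt0)//.
by rewrite le_max lexx orbT.
Qed.

Lemma le_Z_root (eps : R) : 0 < eps -> Bernstein_Markov E mu ->
  exists q, forall d, (0 < d)%N -> W d <= expR (q / d%:R) * (1 + eps) ^+ 2 * zr d.
Proof.
move=> eps0 /(_ eps eps0)[M0 BM0]; pose M := Num.max M0 1.
have M_gt0 : 0 < M by rewrite lt_max ltr01 orbT.
have B_gt0 : 0 < 1 + eps by rewrite addr_gt0.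
(* The root of order 2 l_d of C^(2 m_d) is exp(k ln C / d), where ln C = ln M + d ln(1 + eps). *)
exists (k * ln M) => d d0; pose C := M * (1 + eps) ^+ d.
have C_gt0 : 0 < C by rewrite mulr_gt0 ?exprn_gt0.
have le_sqr : max_VDM alpha E (num_monomials N d) ^+ 2 <=
    (C ^+ 2) ^+ num_monomials N d * fine (Z_ alpha E mu d).
  apply: sqr_max_VDM_le_Z => // Q degQ; apply: le_trans (BM0 d Q degQ) _.
  rewrite lee_wpmul2r ?Lnorm_ge0// lee_fin ler_wpM2r ?exprn_ge0 ?(ltW B_gt0)//.
  by rewrite le_max lexx.
rewrite sqr_powR_root; apply: le_trans (ge0_ler_powR _ _ _ le_sqr) _.
- by rewrite invr_ge0.
- by rewrite nnegrE sqr_ge0.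
- by rewrite nnegrE mulr_ge0 ?fine_ge0 ?Z_ge0// !exprn_ge0// ltW.
rewrite powRM ?fine_ge0 ?Z_ge0 ?exprn_ge0 ?(ltW C_gt0)// ler_wpM2r ?powR_ge0//.
rewrite expr_num_monomials_root ?exprn_gt0//.
rewrite -[X in _ <= _ * X](@lnK _ (_ ^+ 2)) ?posrE ?exprn_gt0// -expRD ler_expR.
rewrite /C !lnXn ?exprn_gt0// lnM ?posrE ?exprn_gt0// lnXn//.
have N0 : 0 < N%:R :> R by rewrite ltr0n.
have dR0 : 0 < d%:R :> R by rewrite ltr0n.
rewrite [leLHS](_ : _ = k * ln M / d%:R + k * ln (1 + eps)); last first.
  rewrite -[ln (1 + eps) *+ d]mulr_natr -mulr_natr.
  field; rewrite !gt_eqF//.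
(* As N >= 1, [k] is at most 2, whence the exponent 2 of [1 + eps]. *)
rewrite lerD2l -[leRHS]mulr_natl ler_wpM2r ?ln_ge0 ?lerDl ?(ltW eps0)//.
by rewrite ler_pdivrMr// -natrM ler_nat mul2n -addnn -addn1 leq_add2l.
Qed.

Lemma cvg_Z_root : Bernstein_Markov E mu ->
  (fun d => zr d) @ \oo --> transfinite_diameter alpha E.
Proof.
move=> BM; have cvgW := cvg_transfinite_diameter N_gt0 halpha cE.
set D := transfinite_diameter alpha E in cvgW *.
have D0 : 0 <= D.
  apply: limr_ge; first by apply/cvg_ex; exists D.
  by near=> d; exact: powR_ge0.
have cvg_inv (q : R) : expR (q / d%:R) @[d --> \oo] --> (1 : R).
  rewrite -[X in _ --> X]expR0; apply: continuous_cvg; first exact: continuous_expR.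
  rewrite -[X in _ --> X](mulr0 q); apply: cvgMr.
  by rewrite -(cvg_shiftS (fun m => m%:R^-1 : R)); exact: cvg_harmonic.
apply/cvgrPdist_le => e e0.
(* D - D / (1 + eps)^2 is at most 2 D eps, which this choice makes smaller than [e]; the [+ 1]
   covers [D = 0]. *)
pose eps := e / (2 * (D + 1)).
have D1 : 0 < D + 1 by rewrite ltr_wpDl.
have eps0 : 0 < eps by rewrite divr_gt0// mulr_gt0.
have [q le_q] := le_Z_root eps0 BM.
have B_gt0 : 0 < (1 + eps) ^+ 2 by rewrite exprn_gt0// addr_gt0.
have cvgl : W d * expR (- q / d%:R) / (1 + eps) ^+ 2 @[d --> \oo] --> D / (1 + eps) ^+ 2.
  by apply: cvgMl; rewrite -[X in _ --> X]mulr1; apply: cvgM cvgW (cvg_inv _).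
pose r := ln (Num.max 1 (fine (mu E))) * k / 2.
have cvgu : W d * expR (r / d%:R) @[d --> \oo] --> D.
  by rewrite -[X in _ --> X]mulr1; apply: cvgM cvgW (cvg_inv _).
have D_lt : D - e < D / (1 + eps) ^+ 2.
  have eE : e = 2 * (D + 1) * eps by rewrite mulrC divfK// gt_eqF// mulr_gt0.
  rewrite ltr_pdivlMr// {1}eE -subr_gt0.
  rewrite [ltRHS](_ : _ = D * (3 * eps ^+ 2 + 2 * eps ^+ 3) + 2 * eps * (1 + eps) ^+ 2); last by ring.
  apply: ltr_wpDl; last by apply: mulr_gt0 => //; exact: mulr_gt0.
  by rewrite mulr_ge0// addr_ge0// mulr_ge0// exprn_ge0// ltW.
near=> d.
have d0 : (0 < d)%N by near: d; exists 1%N.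
have lo : D - e <= zr d.
  apply: (@le_trans _ _ (W d * expR (- q / d%:R) / (1 + eps) ^+ 2)).
    by near: d; apply: (cvgr_ge _ cvgl); exact: D_lt.
  rewrite ler_pdivrMr// mulNr expRN ler_pdivrMr ?expR_gt0//.
  by rewrite -mulrA mulrC [_ * expR _]mulrC; exact: le_q.
have up : zr d <= D + e.
  apply: le_trans (Z_root_le d0) _.
  rewrite [X in expR X](_ : _ = r / d%:R); last by rewrite /r -!mulrA [2^-1 * _]mulrC.
  by near: d; apply: (cvgr_le _ cvgu); rewrite ltrDl.
by rewrite ler_norml; apply/andP; split; lra.
Unshelve. all: by end_near. Qed.

End PartitionFunction.

Theorem theorem3p1 (R : realType) (N : nat) (hN : (0 < N)%N)
    (alpha : nat -> multinom N) (halpha : deglex_listing alpha)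
    (E : set (Cspace R N)) (hE : compact E)
    (mu : {finite_measure set (borelCspace R N) -> \bar R})
    (hmu : mu (~` E) = 0%E)
    (hBM : Bernstein_Markov E mu) :
  (fun d => Z_ alpha E mu d `^ (2 * sum_degrees N d)%:R^-1)%E @ \oo
    --> (transfinite_diameter alpha E)%:E.
Proof.
under eq_fun do rewrite -(fineK (Z_fin_num halpha hE mu _)) poweR_EFin.
by apply: cvg_EFin; [near=> d|exact: cvg_Z_root].
Unshelve. all: by end_near. Qed.
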